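(* For every real $x\neq 0$, the function $\alpha\mapsto E_\alpha(\Gamma(1+\alpha)x)$ is decreasing on $(0,1)$.
   Context: For $\alpha>0$, $E_\alpha$ denotes the Mittag-Leffler function $E_\alpha(z)=\sum_{n\ge 0} \frac{z^n}{\Gamma(1+n\alpha)}$, where $\Gamma$ is the Gamma function. *)

(* Defs.v *)
From Stdlib Require Import Reals.
From Coquelicot Require Import Coquelicot.
Open Scope R_scope.

(* Euler's Gamma function, Gamma(s) = int_0^oo t^(s-1) e^(-t) dt  (meaningful for s > 0;
   only used here at arguments >= 1). *)
Definition Gamma (s : R) : R :=
  RInt_gen (fun t => Rpower t (s - 1) * exp (- t)) (at_right 0) (Rbar_locally p_infty).

Definition MittagLeffler (alpha z : R) : R :=
  Series (fun n => z ^ n / Gamma (1 + INR n * alpha)).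

(* Main.v *)
(** By Euler's limit formula, [Gamma (1 + n b) / Gamma (1 + n a)] is the limit as [N]
grows of [N ^ (n (b - a)) * prod_{1 <= i <= N} (i + n a) / (i + n b)]. The operator on
entire functions multiplying the [n]-th Taylor coefficient by [(i + n a) / (i + n b)] is
[f |-> E f(B _)] for a random variable [B] on [[0, 1]] with an atom at [1] of mass [a /
b]; hence it preserves convexity and satisfies Jensen's inequality with mean [(i + a) / (i
+ b)]. Composing these operators and rescaling the variable transforms [E_b] into [E_a] in
the limit. Starting from [E_1 = exp], this shows that [E_b] is convex for [0 < b < 1];
then Jensen's inequality gives [E_a(y) >= E_b(y Gamma(1 + b) / Gamma(1 + a))]. The
operator for [i = 1] is kept apart until the end: it turns convexity into strict convexity
and makes the inequality strict.

No integral is needed for these operators: if [g] has coefficients [d_n / (A + n c)] then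
[A g + c x g'] has coefficients [d_n], and a minimum principle for this ODE replaces the
averaging. *)
Require Import Defs.
From Stdlib Require Import Reals Lra Lia Psatz Factorial.
From Coquelicot Require Import Coquelicot.
Open Scope R_scope.

(** * The Gamma integral *)

Lemma exp_monotone (x y : R) : x <= y -> exp x <= exp y.
Proof. intros [H| ->]; [left; apply exp_increasing; exact H|right; reflexivity]. Qed.

Lemma filter_prod_0_infty (P : R * R -> Prop) (d M : R) :
  0 < d -> (forall a b, 0 < a < d -> M < b -> P (a, b)) ->
  filter_prod (at_right 0) (Rbar_locally p_infty) P.
Proof.
intros Hd H.
apply (Filter_prod _ _ _ (fun a => 0 < a < d) (fun b => M < b)).
- exists (mkposreal d Hd); intros y Hy Hy0; split; [exact Hy0|].
  unfold ball in Hy; simpl in Hy; unfold AbsRing_ball, abs, minus, plus, opp in Hy; simpl in Hy.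
  apply Rabs_lt_between in Hy; lra.
- exists M; intros; assumption.
- intros a b Ha Hb; apply H; assumption.
Qed.

Lemma ex_RInt_pos (f : R -> R) (a b : R) :
  (forall t, 0 < t -> continuous f t) -> 0 < a <= b -> ex_RInt f a b.
Proof.
intros Hc Hab; apply (ex_RInt_continuous (V := R_CompleteNormedModule)); intros z Hz.
rewrite Rmin_left in Hz by lra; apply Hc; lra.
Qed.

(** For a nonnegative integrand, enlarging the interval increases the integral, so the improper
    integral is the supremum of the proper ones. *)
Lemma is_RInt_gen_bounded (f : R -> R) (C : R) :
  (forall t, 0 < t -> continuous f t) -> (forall t, 0 < t -> 0 <= f t) ->
  (forall a b, 0 < a <= b -> RInt f a b <= C) ->
  exists l, is_RInt_gen f (at_right 0) (Rbar_locally p_infty) l /\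
    forall a b, 0 < a <= b -> RInt f a b <= l.
Proof.
intros Hc Hp HC.
destruct (completeness (fun y => exists a b, 0 < a <= b /\ y = RInt f a b)) as [l [Hub Hleast]].
- exists C; intros y (a & b & Hab & ->); auto.
- exists (RInt f 1 1); exists 1, 1; split; [lra|reflexivity].
- assert (Hl : forall a b, 0 < a <= b -> RInt f a b <= l)
    by (intros a b Hab; apply Hub; exists a, b; auto).
  exists l; split; [|exact Hl].
  intros Q [eps HQ].
  assert (Hex : exists a b, 0 < a <= b /\ l - eps < RInt f a b).
  { apply Classical_Prop.NNPP; intros Hn.
    assert (l <= l - eps).
    { apply Hleast; intros y (a & b & Hab & ->).
      apply Rnot_lt_le; intros Hlt; apply Hn; exists a, b; auto. }
    destruct eps as [e He]; simpl in *; lra. }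
  destruct Hex as (a0 & b0 & Hab0 & Hgt).
  apply (filter_prod_0_infty _ a0 b0); [lra|].
  intros a b Ha Hb; simpl.
  exists (RInt f a b); split.
  { apply (RInt_correct f), ex_RInt_pos; [exact Hc|lra]. }
  apply HQ.
  assert (H1 : RInt f a b <= l) by (apply Hl; lra).
  (* [[a, b]] contains the almost optimal interval [[a0, b0]]; the two extra pieces contribute
     nonnegative amounts. *)
  assert (H2 : RInt f a0 b0 <= RInt f a b).
  { rewrite <- (RInt_Chasles f a a0 b) by (apply ex_RInt_pos; [exact Hc|lra]).
    rewrite <- (RInt_Chasles f a0 b0 b) by (apply ex_RInt_pos; [exact Hc|lra]).
    assert (0 <= RInt f a a0).
    { apply RInt_ge_0; [lra|apply ex_RInt_pos; [exact Hc|lra]|intros; apply Hp; lra]. }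
    assert (0 <= RInt f b0 b).
    { apply RInt_ge_0; [lra|apply ex_RInt_pos; [exact Hc|lra]|intros; apply Hp; lra]. }
    unfold plus; simpl; lra. }
  unfold ball; simpl; unfold AbsRing_ball, abs, minus, plus, opp; simpl.
  apply Rabs_lt_between'; lra.
Qed.

Lemma is_RInt_gen_le (f g : R -> R) (lf lg : R) :
  (forall t, 0 < t -> 0 <= f t <= g t) ->
  is_RInt_gen f (at_right 0) (Rbar_locally p_infty) lf ->
  is_RInt_gen g (at_right 0) (Rbar_locally p_infty) lg -> lf <= lg.
Proof.
intros H Hf Hg.
apply Rle_trans with (1 := Rle_abs lf).
apply (RInt_gen_norm (V := R_CompleteNormedModule)
  (Fa := at_right 0) (Fb := Rbar_locally p_infty) f g lf lg); try assumption.
- apply (filter_prod_0_infty _ 1 1); [lra|]; simpl; intros; lra.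
- apply (filter_prod_0_infty _ 1 1); [lra|]; simpl; intros a b Ha Hb t Ht.
  unfold norm; simpl; unfold abs; simpl; rewrite Rabs_pos_eq; apply H; lra.
Qed.

(** The integrand of [Gamma (1 + s)]: the shift by 1 leaves the exponent [s], so only [s >= 0] is
    considered. *)
Definition gamma_kernel (s t : R) : R := Rpower t s * exp (- t).

Lemma gamma_kernel_pos (s t : R) : 0 < gamma_kernel s t.
Proof. apply Rmult_lt_0_compat; apply exp_pos. Qed.

Lemma continuous_gamma_kernel (s t : R) : 0 < t -> continuous (gamma_kernel s) t.
Proof.
intros Ht; apply (ex_derive_continuous (gamma_kernel s)).
unfold gamma_kernel, Rpower; auto_derive; exact Ht.
Qed.

Lemma ln_le_sub1 (x : R) : 0 < x -> ln x <= x - 1.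
Proof.
intros Hx; rewrite <- (ln_exp (x - 1)); apply ln_le; [exact Hx|].
generalize (exp_ineq1_le (x - 1)); lra.
Qed.

(** Half of the exponential decay absorbs the power. *)
Lemma gamma_kernel_le (s : R) : 0 <= s ->
  exists C, 0 < C /\ forall t, 0 < t -> gamma_kernel s t <= C * exp (- (t / 2)).
Proof.
intros [Hs| <-].
(* This is the maximum of [t ^ s * exp (- t / 2)], reached at [t = 2 s]; it comes from
   [ln u <= u - 1] at [u = t / (2 s)]. *)
- exists (exp (s * (ln (2 * s) - 1))); split; [apply exp_pos|].
  intros t Ht; unfold gamma_kernel, Rpower; rewrite <- !exp_plus.
  apply exp_monotone.
  assert (H := ln_le_sub1 (t / (2 * s)) ltac:(apply Rdiv_lt_0_compat; lra)).
  rewrite ln_div in H by lra.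
  apply (Rmult_le_compat_l s) in H; [|lra].
  replace (s * (t / (2 * s) - 1)) with (t / 2 - s) in H by (field; lra).
  lra.
- exists 1; split; [lra|]; intros t Ht; unfold gamma_kernel.
  rewrite Rpower_O by exact Ht; rewrite !Rmult_1_l; apply exp_monotone; lra.
Qed.

Lemma gamma_kernel_int_bounded (s : R) : 0 <= s ->
  exists C, forall a b, 0 < a <= b -> RInt (gamma_kernel s) a b <= C.
Proof.
intros Hs; destruct (gamma_kernel_le s Hs) as (C & HC & Hle).
exists (2 * C); intros a b Hab.
assert (HI : is_RInt (fun t => C * exp (- (t / 2))) a b
               (- 2 * C * exp (- (b / 2)) - - 2 * C * exp (- (a / 2)))).
{ apply (is_RInt_derive (fun t => - 2 * C * exp (- (t / 2)))).
  - intros t _; auto_derive; [exact I|]; unfold Rdiv; field.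
  - intros t _; apply (ex_derive_continuous (fun t => C * exp (- (t / 2)))).
    auto_derive; exact I. }
apply Rle_trans with (RInt (fun t => C * exp (- (t / 2))) a b).
- apply RInt_le; [lra| | |].
  + apply ex_RInt_pos; [apply continuous_gamma_kernel|exact Hab].
  + eexists; exact HI.
  + intros t Ht; apply Hle; lra.
- rewrite (is_RInt_unique _ _ _ _ HI).
  assert (exp (- (a / 2)) <= 1) by (rewrite <- exp_0; apply exp_monotone; lra).
  generalize (exp_pos (- (b / 2))); nra.
Qed.

Lemma Gamma_spec (s : R) : 0 <= s ->
  is_RInt_gen (gamma_kernel s) (at_right 0) (Rbar_locally p_infty) (Gamma (1 + s)) /\
  0 < Gamma (1 + s).
Proof.
intros Hs; destruct (gamma_kernel_int_bounded s Hs) as [C HC].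
destruct (is_RInt_gen_bounded (gamma_kernel s) C) as (l & Hl & Hge); [| |exact HC|].
- apply continuous_gamma_kernel.
- intros t _; apply Rlt_le, gamma_kernel_pos.
- assert (HG : Gamma (1 + s) = l).
  { unfold Gamma; replace (1 + s - 1) with s by ring.
    apply is_RInt_gen_unique; exact Hl. }
  rewrite HG; split; [exact Hl|].
  apply Rlt_le_trans with (RInt (gamma_kernel s) 1 2); [|apply Hge; lra].
  apply RInt_gt_0; [lra|intros; apply gamma_kernel_pos|].
  intros t Ht; apply continuous_gamma_kernel; lra.
Qed.

Lemma is_lim_gamma_kernel_infty (s : R) : 0 <= s ->
  filterlim (gamma_kernel s) (Rbar_locally p_infty) (locally 0).
Proof.
intros Hs; destruct (gamma_kernel_le s Hs) as (C & HC & Hle).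
apply (filterlim_le_le (fun _ => 0) (gamma_kernel s) (fun t => C * exp (- (t / 2))) 0).
- exists 0; intros t Ht; split; [apply Rlt_le, gamma_kernel_pos|apply Hle; exact Ht].
- apply filterlim_const.
- assert (H : is_lim (fun t => C * exp (- (t / 2))) p_infty 0).
  { replace (Finite 0) with (Rbar_mult C 0) by (simpl; f_equal; ring).
    apply is_lim_scal_l.
    apply (is_lim_comp exp (fun t => - (t / 2)) p_infty 0 m_infty).
    - exact is_lim_exp_m.
    - apply (is_lim_ext (fun t => (- / 2) * t)); [intros; field|].
      replace m_infty with (Rbar_mult (- / 2) p_infty).
      + apply is_lim_scal_l, is_lim_id.
      + simpl; destruct (Rle_dec 0 (- / 2)) as [h|h]; [exfalso; lra|reflexivity].
    - exists 0; intros t _; discriminate. }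
  exact H.
Qed.

Lemma is_lim_gamma_kernel_0 (s : R) : 0 <= s ->
  filterlim (gamma_kernel (s + 1)) (at_right 0) (locally 0).
Proof.
intros Hs.
apply (filterlim_le_le (fun _ => 0) (gamma_kernel (s + 1)) (fun t => t) 0).
- exists (mkposreal 1 Rlt_0_1); intros t Ht Ht0.
  unfold ball in Ht; simpl in Ht; unfold AbsRing_ball, abs, minus, plus, opp in Ht; simpl in Ht.
  apply Rabs_lt_between in Ht.
  split; [apply Rlt_le, gamma_kernel_pos|].
  unfold gamma_kernel; rewrite Rpower_plus, Rpower_1 by exact Ht0.
  assert (0 < Rpower t s <= 1).
  { split; [apply exp_pos|]; unfold Rpower; rewrite <- exp_0; apply exp_monotone.
    assert (ln t <= 0) by (generalize (ln_le_sub1 t Ht0); lra). nra. }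
  assert (0 < exp (- t) <= 1).
  { split; [apply exp_pos|]; rewrite <- exp_0; apply exp_monotone; lra. }
  assert (Rpower t s * exp (- t) <= 1) by nra.
  nra.
- apply filterlim_const.
- intros P [e He]; exists e; intros y Hy _; apply He; exact Hy.
Qed.

(** Integration by parts: the derivative of [gamma_kernel (s + 1)] has integral 0 because the kernel
    vanishes at both ends, and it equals [(s + 1) * gamma_kernel s - gamma_kernel (s + 1)]. *)
Lemma Gamma_succ (s : R) : 0 <= s -> Gamma (1 + (s + 1)) = (s + 1) * Gamma (1 + s).
Proof.
intros Hs.
destruct (Gamma_spec s Hs) as [H0 _].
destruct (Gamma_spec (s + 1) ltac:(lra)) as [H1 _].
assert (HD : forall t, 0 < t -> is_derive (gamma_kernel (s + 1)) t
               ((s + 1) * gamma_kernel s t - gamma_kernel (s + 1) t)).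
{ intros t Ht; unfold gamma_kernel, Rpower; auto_derive; [exact Ht|].
  replace (exp ((s + 1) * ln t)) with (exp (s * ln t) * t).
  - field; lra.
  - rewrite Rmult_plus_distr_r, exp_plus, Rmult_1_l, exp_ln by exact Ht; reflexivity. }
assert (HI : is_RInt_gen (Derive (gamma_kernel (s + 1))) (at_right 0) (Rbar_locally p_infty) (0 - 0)).
{ apply is_RInt_gen_Derive.
  - apply (filter_prod_0_infty _ 1 1); [lra|]; simpl; intros a b Ha Hb t.
    rewrite Rmin_left by lra; intros Ht; eexists; apply HD; lra.
  - apply (filter_prod_0_infty _ 1 1); [lra|]; simpl; intros a b Ha Hb t.
    rewrite Rmin_left by lra; intros Ht.
    apply (continuous_ext_loc _ (fun t => (s + 1) * gamma_kernel s t - gamma_kernel (s + 1) t)).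
    + assert (Ht0 : 0 < t) by lra.
      exists (mkposreal t Ht0); intros y Hy.
      unfold ball in Hy; simpl in Hy; unfold AbsRing_ball, abs, minus, plus, opp in Hy; simpl in Hy.
      apply Rabs_lt_between in Hy.
      symmetry; apply is_derive_unique, HD; lra.
    + apply (continuous_minus (V := R_NormedModule)).
      * apply (continuous_scal_r (V := R_NormedModule) (s + 1)), continuous_gamma_kernel; lra.
      * apply continuous_gamma_kernel; lra.
  - apply is_lim_gamma_kernel_0; exact Hs.
  - apply is_lim_gamma_kernel_infty; lra. }
assert (HI' : is_RInt_gen (Derive (gamma_kernel (s + 1))) (at_right 0) (Rbar_locally p_infty)
                ((s + 1) * Gamma (1 + s) - Gamma (1 + (s + 1)))).
{ apply (is_RInt_gen_ext (fun t => (s + 1) * gamma_kernel s t - gamma_kernel (s + 1) t)).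
  - apply (filter_prod_0_infty _ 1 1); [lra|]; simpl; intros a b Ha Hb t.
    rewrite Rmin_left by lra; intros Ht.
    symmetry; apply is_derive_unique, HD; lra.
  - apply (is_RInt_gen_minus (V := R_NormedModule)); [|exact H1].
    apply (is_RInt_gen_scal (V := R_NormedModule)); exact H0. }
apply (is_RInt_gen_unique (V := R_CompleteNormedModule)) in HI.
apply (is_RInt_gen_unique (V := R_CompleteNormedModule)) in HI'.
rewrite HI in HI'; lra.
Qed.

Lemma Gamma_1 : Gamma (1 + 0) = 1.
Proof.
destruct (Gamma_spec 0 (Rle_refl 0)) as [H0 _].
apply (is_RInt_gen_unique (V := R_CompleteNormedModule)) in H0; rewrite <- H0; clear H0.
assert (HD : forall t, is_derive (fun t => - exp (- t)) t (exp (- t))).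
{ intros t; auto_derive; [exact I|ring]. }
assert (HI : is_RInt_gen (Derive (fun t => - exp (- t))) (at_right 0) (Rbar_locally p_infty)
               (- 0 - - exp (- 0))).
{ apply is_RInt_gen_Derive.
  + apply (filter_prod_0_infty _ 1 1); [lra|]; simpl; intros a b Ha Hb t _; eexists; apply HD.
  + apply (filter_prod_0_infty _ 1 1); [lra|]; simpl; intros a b Ha Hb t _.
    apply (continuous_ext (fun t => exp (- t))).
    { intros y; symmetry; apply is_derive_unique, HD. }
    apply (ex_derive_continuous (fun t => exp (- t))); auto_derive; exact I.
  (* [- exp (- t)] is continuous at 0, so its one-sided limit is its value there. *)
  + apply (filterlim_filter_le_1 (F := locally 0)).
    { intros P [e He]; exists e; intros y Hy _; apply He; exact Hy. }
    apply (ex_derive_continuous (fun t => - exp (- t))); eexists; apply HD.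
  + apply (filterlim_ext_loc (fun t => - gamma_kernel 0 t)).
    * exists 0; intros t Ht; unfold gamma_kernel; rewrite Rpower_O by lra; ring.
    * apply (filterlim_comp _ _ _ (gamma_kernel 0) Ropp _ (locally 0)).
      { apply is_lim_gamma_kernel_infty; lra. }
      apply (filterlim_opp (K := R_AbsRing) (V := R_NormedModule) 0). }
replace (- 0 - - exp (- 0)) with 1 in HI by (rewrite Ropp_0, exp_0; ring).
apply (is_RInt_gen_unique (V := R_CompleteNormedModule)).
apply (is_RInt_gen_ext (Derive (fun t => - exp (- t)))).
- apply (filter_prod_0_infty _ 1 1); [lra|]; simpl; intros a b Ha Hb t.
  rewrite Rmin_left by lra; intros Ht; etransitivity; [apply is_derive_unique, HD|].
  unfold gamma_kernel; rewrite Rpower_O by lra; ring.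
- exact HI.
Qed.

(** With [u = ln y], the tangent of [exp] at [s u] lies below [exp] at 0 ([H1]) and at [u] ([H2]);
    in the average with weights [1 - s] and [s] the linear terms cancel. *)
Lemma Rpower_le_chord (y s : R) : 0 < y -> 0 <= s <= 1 -> Rpower y s <= 1 - s + s * y.
Proof.
intros Hy Hs; unfold Rpower; set (u := ln y).
assert (Hu : exp u = y) by (apply exp_ln; exact Hy).
assert (H1 : exp (s * u) * (1 - s * u) <= 1).
{ replace 1 with (exp (s * u) * exp (- (s * u))) at 2
    by (rewrite <- exp_plus, Rplus_opp_r; apply exp_0).
  apply Rmult_le_compat_l; [apply Rlt_le, exp_pos|].
  generalize (exp_ineq1_le (- (s * u))); lra. }
assert (H2 : exp (s * u) * (1 + (1 - s) * u) <= y).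
{ apply Rle_trans with (exp (s * u) * exp ((1 - s) * u)).
  - apply Rmult_le_compat_l; [apply Rlt_le, exp_pos|apply exp_ineq1_le].
  - rewrite <- exp_plus; replace (s * u + (1 - s) * u) with u by ring; lra. }
assert (H3 := Rmult_le_compat_l (1 - s) _ _ ltac:(lra) H1).
assert (H4 := Rmult_le_compat_l s _ _ ltac:(lra) H2).
lra.
Qed.

(** The chord inequality at [y = t / A], integrated against [gamma_kernel A]; the term in [t]
    produces [Gamma (1 + (A + 1))], which [Gamma_succ] reduces. *)
Lemma Gamma_shift_le (A s : R) : 0 < A -> 0 <= s <= 1 ->
  Gamma (1 + (A + s)) <= Rpower A s * (1 + s / A) * Gamma (1 + A).
Proof.
intros HA Hs.
destruct (Gamma_spec A ltac:(lra)) as [H0 _].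
destruct (Gamma_spec (A + 1) ltac:(lra)) as [H1 _].
destruct (Gamma_spec (A + s) ltac:(lra)) as [H2 _].
replace (Rpower A s * (1 + s / A) * Gamma (1 + A))
  with (Rpower A s * (1 - s) * Gamma (1 + A) + Rpower A s * (s / A) * Gamma (1 + (A + 1)))
  by (rewrite (Gamma_succ A ltac:(lra)); field; lra).
apply (is_RInt_gen_le (gamma_kernel (A + s))
  (fun t => Rpower A s * (1 - s) * gamma_kernel A t + Rpower A s * (s / A) * gamma_kernel (A + 1) t)).
- intros t Ht; split; [apply Rlt_le, gamma_kernel_pos|].
  unfold gamma_kernel; rewrite !Rpower_plus, Rpower_1 by exact Ht.
  assert (Hts : Rpower t s = Rpower A s * Rpower (t / A) s).
  { rewrite Rpower_mult_distr by (try apply Rdiv_lt_0_compat; lra); f_equal; field; lra. }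
  rewrite Hts.
  assert (H := Rpower_le_chord (t / A) s ltac:(apply Rdiv_lt_0_compat; lra) Hs).
  assert (0 < Rpower t A * exp (- t) * Rpower A s)
    by (repeat apply Rmult_lt_0_compat; apply exp_pos).
  apply (Rmult_le_compat_l (Rpower t A * exp (- t) * Rpower A s)) in H; [|lra].
  eapply Rle_trans; [eapply Rle_trans; [|exact H]|]; apply Req_le; field; lra.
- exact H2.
- apply (is_RInt_gen_plus (V := R_NormedModule));
  apply (is_RInt_gen_scal (V := R_NormedModule)); assumption.
Qed.

(** * Euler's limit formula *)

Fixpoint rising (N : nat) (s : R) : R :=
  match N with
  | O => 1
  | S k => rising k s * (1 + s / INR (S k))
  end.

(** The approximants of [/ Gamma (1 + s)] in Euler's formula, where [rising N s] is
    [(1 + s) ... (N + s) / N!]. Limits and monotonicity are stated at [S N] to keep the base of the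
    power positive. *)
Definition euler (N : nat) (s : R) : R := rising N s / Rpower (INR N) s.

Lemma INR_S_pos (n : nat) : 0 < INR (S n).
Proof. apply lt_0_INR; lia. Qed.

Lemma rising_pos (N : nat) (s : R) : 0 <= s -> 0 < rising N s.
Proof.
intros Hs; induction N as [|N IH]; cbn [rising]; [lra|].
apply Rmult_lt_0_compat; [exact IH|].
assert (0 <= s / INR (S N)) by (apply Rdiv_le_0_compat; [exact Hs|apply INR_S_pos]).
lra.
Qed.

Lemma euler_pos (N : nat) (s : R) : 0 <= s -> 0 < euler N s.
Proof. intros Hs; apply Rdiv_lt_0_compat; [apply rising_pos, Hs|apply exp_pos]. Qed.

Lemma Gamma_rising (N : nat) (s : R) : 0 <= s ->
  Gamma (1 + (INR N + s)) = rising N s * INR (fact N) * Gamma (1 + s).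
Proof.
intros Hs; induction N as [|N IH].
- simpl; rewrite Rplus_0_l; ring.
- replace (INR (S N) + s) with (INR N + s + 1) by (rewrite S_INR; ring).
  assert (HN := pos_INR N); assert (HN1 := INR_S_pos N).
  rewrite Gamma_succ by lra; rewrite IH; cbn [rising].
  rewrite fact_simpl, mult_INR, S_INR; rewrite S_INR in HN1; field; lra.
Qed.

Lemma Gamma_fact (N : nat) : Gamma (1 + INR N) = INR (fact N).
Proof.
replace (INR N) with (INR N + 0) at 1 by ring.
rewrite Gamma_rising, Gamma_1 by lra.
assert (H : rising N 0 = 1).
{ induction N as [|N IH]; cbn [rising]; [reflexivity|].
  rewrite IH; unfold Rdiv; ring. }
rewrite H; ring.
Qed.

Lemma is_lim_seq_inv_succ : is_lim_seq (fun N => / INR (S N)) 0.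
Proof.
apply (is_lim_seq_incr_1 (fun N => / INR N)).
replace (Finite 0) with (Rbar_inv p_infty) by reflexivity.
apply is_lim_seq_inv; [apply is_lim_seq_INR|discriminate].
Qed.

Definition Gamma_ratio (s : R) (N : nat) : R :=
  Gamma (1 + (INR N + s)) / (INR (fact N) * Rpower (INR N) s).

(** [Gamma_shift_le] is used twice: the shift by [s] from [n] gives the upper bound, the shift by
    [1 - s] from [n + s] to [n + 1] gives the lower one. *)
Lemma Gamma_ratio_bounds (s : R) (N : nat) : 0 <= s <= 1 ->
  1 <= Gamma_ratio s (S N) <= 1 + s * / INR (S N).
Proof.
intros Hs; unfold Gamma_ratio; set (n := INR (S N)).
assert (Hn : 0 < n) by apply INR_S_pos.
assert (Hf : 0 < INR (fact (S N))) by apply INR_fact_lt_0.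
assert (HG := Gamma_fact (S N)); fold n in HG.
assert (HD : 0 < INR (fact (S N)) * Rpower n s) by (apply Rmult_lt_0_compat; [exact Hf|apply exp_pos]).
assert (Hup := Gamma_shift_le n s Hn Hs).
assert (Hlo := Gamma_shift_le (n + s) (1 - s) ltac:(lra) ltac:(lra)).
replace (n + s + (1 - s)) with (n + 1) in Hlo by ring.
rewrite Gamma_succ, HG in Hlo by lra; rewrite HG in Hup.
split.
- apply (Rmult_le_reg_r (INR (fact (S N)) * Rpower n s)); [exact HD|].
  unfold Rdiv; rewrite Rmult_assoc, Rinv_l, Rmult_1_l, Rmult_1_r by lra.
  unfold Rminus in Hlo at 1; rewrite Rpower_plus, Rpower_1, Rpower_Ropp in Hlo by lra.
  assert (Hns : Rpower n s <= Rpower (n + s) s) by (apply Rle_Rpower_l; lra).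
  assert (Hp : 0 < Rpower (n + s) s) by apply exp_pos.
  (* [(n + s) * (1 + (1 - s) / (n + s))] is [n + 1], which cancels the factor from
     [Gamma (1 + (n + 1)) = (n + 1) n!]. *)
  replace ((n + s) * / Rpower (n + s) s * (1 + (1 - s) / (n + s)) * Gamma (1 + (n + s)))
    with ((n + 1) * (Gamma (1 + (n + s)) / Rpower (n + s) s)) in Hlo by (field; lra).
  apply Rmult_le_reg_l in Hlo; [|lra].
  apply (Rmult_le_compat_r (Rpower (n + s) s)) in Hlo; [|lra].
  unfold Rdiv in Hlo; rewrite Rmult_assoc, Rinv_l, Rmult_1_r in Hlo by lra.
  nra.
- apply (Rmult_le_reg_r (INR (fact (S N)) * Rpower n s)); [exact HD|].
  unfold Rdiv; rewrite Rmult_assoc, Rinv_l, Rmult_1_r by lra.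
  unfold Rdiv in Hup; lra.
Qed.

(** For [s <= 1] the previous bounds squeeze the ratio; raising [s - 1] to [s] multiplies it by
    [1 + s / (N + 1)], which tends to 1. *)
Lemma is_lim_Gamma_ratio (k : nat) : forall s, 0 <= s <= INR k + 1 ->
  is_lim_seq (fun N => Gamma_ratio s (S N)) 1.
Proof.
induction k as [|k IH]; intros s Hs.
- simpl in Hs.
  apply (is_lim_seq_le_le (fun _ => 1) _ (fun N => 1 + s * / INR (S N))).
  + intros N; apply Gamma_ratio_bounds; lra.
  + apply is_lim_seq_const.
  + replace (Finite 1) with (Finite (1 + s * 0)) by (f_equal; ring).
    apply is_lim_seq_plus'; [apply is_lim_seq_const|].
    apply (is_lim_seq_scal_l _ s 0), is_lim_seq_inv_succ.
- destruct (Rle_dec s (INR k + 1)) as [Hle|Hgt]; [apply IH; lra|].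
  rewrite S_INR in Hs; assert (Hk := pos_INR k).
  apply (is_lim_seq_ext (fun N => (1 + s * / INR (S N)) * Gamma_ratio (s - 1) (S N))).
  + intros N; unfold Gamma_ratio; assert (HN := INR_S_pos N).
    assert (Hf : 0 < INR (fact (S N))) by apply INR_fact_lt_0.
    set (n := INR (S N)) in *.
    replace (n + s) with (n + (s - 1) + 1) by ring.
    rewrite Gamma_succ by lra.
    replace (Rpower n s) with (Rpower n (s - 1) * n).
    2:{ rewrite <- (Rpower_1 n) at 2 by exact HN; rewrite <- Rpower_plus; f_equal; ring. }
    assert (0 < Rpower n (s - 1)) by apply exp_pos.
    field; lra.
  + replace (Finite 1) with (Finite ((1 + s * 0) * 1)) by (f_equal; ring).
    apply is_lim_seq_mult'; [|apply IH; lra].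
    apply is_lim_seq_plus'; [apply is_lim_seq_const|].
    apply (is_lim_seq_scal_l _ s 0), is_lim_seq_inv_succ.
Qed.

Lemma is_lim_euler (s : R) : 0 <= s ->
  is_lim_seq (fun N => euler (S N) s) (/ Gamma (1 + s)).
Proof.
intros Hs; destruct (Gamma_spec s Hs) as [_ HG].
destruct (nfloor_ex s Hs) as [k Hk].
apply (is_lim_seq_ext (fun N => Gamma_ratio s (S N) * / Gamma (1 + s))).
- intros N; unfold Gamma_ratio, euler; rewrite Gamma_rising by exact Hs.
  assert (Hf : 0 < INR (fact (S N))) by apply INR_fact_lt_0.
  assert (0 < Rpower (INR (S N)) s) by apply exp_pos.
  field; lra.
- replace (Finite (/ Gamma (1 + s))) with (Finite (1 * / Gamma (1 + s))) by (f_equal; ring).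
  apply is_lim_seq_mult'; [|apply is_lim_seq_const].
  apply (is_lim_Gamma_ratio k); lra.
Qed.

(** With [n = N + 1], [1 + s / (n + 1) <= exp (s / (n + 1)) <= ((n + 1) / n) ^ s], because
    [ln ((n + 1) / n) >= 1 / (n + 1)]. Monotonicity places the approximants above their limit and
    lets one of them dominate all later ones. *)
Lemma euler_succ_le (N : nat) (s : R) : 0 <= s -> euler (S (S N)) s <= euler (S N) s.
Proof.
intros Hs; unfold euler.
change (rising (S (S N)) s) with (rising (S N) s * (1 + s / INR (S (S N)))).
assert (Hn := INR_S_pos N); rewrite (S_INR (S N)); set (n := INR (S N)) in *.
assert (Hr := rising_pos (S N) s Hs); set (r := rising (S N) s) in *.
assert (H : (1 + s / (n + 1)) * Rpower n s <= Rpower (n + 1) s).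
{ unfold Rpower; replace (s * ln (n + 1)) with (s * (ln (n + 1) - ln n) + s * ln n) by ring.
  rewrite exp_plus; apply Rmult_le_compat_r; [apply Rlt_le, exp_pos|].
  apply Rle_trans with (exp (s / (n + 1))); [apply exp_ineq1_le|].
  apply exp_monotone; unfold Rdiv; apply Rmult_le_compat_l; [exact Hs|].
  assert (Hl := ln_le_sub1 (n / (n + 1)) ltac:(apply Rdiv_lt_0_compat; lra)).
  rewrite ln_div in Hl by lra.
  replace (n / (n + 1) - 1) with (- / (n + 1)) in Hl by (field; lra).
  lra. }
assert (0 < Rpower n s) by apply exp_pos.
assert (0 < Rpower (n + 1) s) by apply exp_pos.
apply (Rmult_le_reg_r (Rpower n s * Rpower (n + 1) s)); [apply Rmult_lt_0_compat; assumption|].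
replace (r * (1 + s / (n + 1)) / Rpower (n + 1) s * (Rpower n s * Rpower (n + 1) s))
  with (r * ((1 + s / (n + 1)) * Rpower n s)) by (field; lra).
replace (r / Rpower n s * (Rpower n s * Rpower (n + 1) s)) with (r * Rpower (n + 1) s) by (field; lra).
apply Rmult_le_compat_l; lra.
Qed.

Lemma euler_antitone (s : R) (M N : nat) : 0 <= s -> (M <= N)%nat ->
  euler (S N) s <= euler (S M) s.
Proof.
intros Hs HMN; induction HMN as [|N _ IH]; [apply Rle_refl|].
apply Rle_trans with (2 := IH), euler_succ_le, Hs.
Qed.

Lemma inv_Gamma_le_euler (s : R) (N : nat) : 0 <= s -> / Gamma (1 + s) <= euler (S N) s.
Proof.
intros Hs.
apply (is_lim_seq_decr_compare (fun N => euler (S N) s) _ (is_lim_euler s Hs)).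
intros n; apply euler_succ_le, Hs.
Qed.

(** * Entire power series *)

(** Equivalent to an infinite radius of convergence; explicit bounds are what can be made uniform in
    a parameter. *)
Definition entire (d : nat -> R) : Prop :=
  forall r, 0 < r -> exists B, forall n, Rabs (d n) * r ^ n <= B.

(** The threshold [M] may depend on [r]: the dominating [euler (S N) (INR n * a)] is a polynomial in
    [n] divided by [(N + 1) ^ (n a)], which controls [r ^ n] only for large [N]. *)
Definition uniformly_entire (e : nat -> nat -> R) : Prop :=
  forall r, 0 < r -> exists M B, forall N n, (M <= N)%nat -> Rabs (e N n) * r ^ n <= B.

Lemma entire_radius (d : nat -> R) (x : R) : entire d -> Rbar_lt (Rabs x) (CV_radius d).
Proof.
intros Hd; destruct (CV_radius_bounded d) as [Hub _].
assert (Hx := Rabs_pos x).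
apply Rbar_lt_le_trans with (Finite (Rabs x + 1)); [simpl; lra|].
apply Hub; destruct (Hd (Rabs x + 1) ltac:(lra)) as [B HB].
exists B; intros n; rewrite Rabs_mult, (Rabs_pos_eq ((Rabs x + 1) ^ n)) by (apply pow_le; lra).
apply HB.
Qed.

Lemma entire_ex (d : nat -> R) (x : R) : entire d -> ex_pseries d x.
Proof. intros Hd; apply CV_radius_inside, entire_radius, Hd. Qed.

Lemma entire_mult (d w : nat -> R) (K : R) :
  entire d -> (forall n, Rabs (w n) <= K) -> entire (fun n => d n * w n).
Proof.
intros Hd Hw r Hr; destruct (Hd r Hr) as [B HB]; exists (B * K); intros n.
rewrite Rabs_mult.
replace (Rabs (d n) * Rabs (w n) * r ^ n) with (Rabs (d n) * r ^ n * Rabs (w n)) by ring.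
apply Rmult_le_compat; try apply Rabs_pos; auto.
apply Rmult_le_pos; [apply Rabs_pos|apply pow_le; lra].
Qed.

(** Doubling the radius absorbs the factor [n + 1] of differentiation, since
    [n + 1 <= 2 ^ (n + 1)]. *)
Lemma PS_derive_bound (d : nat -> R) (r B : R) : 0 < r ->
  (forall n, Rabs (d n) * (2 * r) ^ n <= B) ->
  forall n, Rabs (PS_derive d n) * r ^ n <= B / r.
Proof.
intros Hr HB n; unfold PS_derive.
apply (Rmult_le_reg_r r); [exact Hr|].
unfold Rdiv; rewrite (Rmult_assoc B), Rinv_l, Rmult_1_r by lra.
apply Rle_trans with (2 := HB (S n)).
rewrite Rabs_mult, (Rabs_pos_eq (INR (S n))), Rpow_mult_distr by apply pos_INR.
assert (H2 : INR (S n) <= 2 ^ S n).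
{ generalize (poly (S n) 1 Rlt_0_1); rewrite Rmult_1_r; replace (1 + 1) with 2 by ring; lra. }
replace (INR (S n) * Rabs (d (S n)) * r ^ n * r) with (Rabs (d (S n)) * r ^ S n * INR (S n))
  by (simpl pow; ring).
replace (Rabs (d (S n)) * (2 ^ S n * r ^ S n)) with (Rabs (d (S n)) * r ^ S n * 2 ^ S n) by ring.
apply Rmult_le_compat_l; [|exact H2].
apply Rmult_le_pos; [apply Rabs_pos|apply pow_le; lra].
Qed.

Lemma entire_derive (d : nat -> R) : entire d -> entire (PS_derive d).
Proof.
intros Hd r Hr; destruct (Hd (2 * r) ltac:(lra)) as [B HB].
exists (B / r); apply PS_derive_bound; assumption.
Qed.

Lemma uniformly_entire_derive (e : nat -> nat -> R) :
  uniformly_entire e -> uniformly_entire (fun N => PS_derive (e N)).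
Proof.
intros He r Hr; destruct (He (2 * r) ltac:(lra)) as (M & B & HB).
exists M, (B / r); intros N n HN; apply PS_derive_bound; auto.
Qed.

Lemma entire_lim (e : nat -> nat -> R) (d : nat -> R) :
  uniformly_entire e -> (forall n, is_lim_seq (fun N => e N n) (d n)) -> entire d.
Proof.
intros He Hl r Hr; destruct (He r Hr) as (M & B & HB); exists B; intros n.
apply (is_lim_seq_le_loc (fun N => Rabs (e N n) * r ^ n) (fun _ => B) (Rabs (d n) * r ^ n) B).
- exists M; intros N HN; apply HB, HN.
- apply is_lim_seq_mult'; [|apply is_lim_seq_const].
  apply (is_lim_seq_abs _ (Finite (d n))), Hl.
- apply is_lim_seq_const.
Qed.

(** As [r >= 2 |x|], the term of index [k] is at most [B / 2 ^ k], and these bounds sum to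
    [B / 2 ^ n] over [k > n]. *)
Lemma PSeries_tail_bound (d : nat -> R) (x r B : R) : entire d ->
  2 * Rabs x <= r -> (forall n, Rabs (d n) * r ^ n <= B) ->
  forall n, Rabs (PSeries d x - sum_f_R0 (fun k => d k * x ^ k) n) <= B * (/ 2) ^ n.
Proof.
intros Hd Hx HB n.
assert (Hterm : forall k, Rabs (d k * x ^ k) <= B * (/ 2) ^ k).
{ intros k; rewrite Rabs_mult, <- RPow_abs.
  apply Rle_trans with (Rabs (d k) * r ^ k * (/ 2) ^ k).
  - rewrite Rmult_assoc, <- Rpow_mult_distr; apply Rmult_le_compat_l; [apply Rabs_pos|].
    apply pow_incr; split; [apply Rabs_pos|lra].
  - apply Rmult_le_compat_r; [apply pow_le; lra|apply HB]. }
rewrite (PSeries_decr_n d n x) by (apply entire_ex, Hd).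
replace (sum_f_R0 (fun k => d k * x ^ k) n + x ^ S n * PSeries (PS_decr_n d (S n)) x
         - sum_f_R0 (fun k => d k * x ^ k) n)
  with (x ^ S n * PSeries (PS_decr_n d (S n)) x) by ring.
unfold PSeries; rewrite <- Series_scal_l.
assert (Hgeo : is_series (fun k => B * (/ 2) ^ S n * (/ 2) ^ k) (B * (/ 2) ^ n)).
{ replace (B * (/ 2) ^ n) with (B * (/ 2) ^ S n * / (1 - / 2)) by (simpl pow; field).
  apply (is_series_scal_l (B * (/ 2) ^ S n) (fun k => (/ 2) ^ k)).
  apply is_series_geom; rewrite Rabs_pos_eq; lra. }
assert (Hle : forall k, 0 <= Rabs (x ^ S n * (PS_decr_n d (S n) k * x ^ k))
                      <= B * (/ 2) ^ S n * (/ 2) ^ k).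
{ intros k; split; [apply Rabs_pos|]; unfold PS_decr_n.
  replace (x ^ S n * (d (S n + k)%nat * x ^ k)) with (d (S n + k)%nat * x ^ (S n + k))
    by (rewrite pow_add; ring).
  rewrite Rmult_assoc, <- pow_add; apply Hterm. }
rewrite <- (is_series_unique _ _ Hgeo).
eapply Rle_trans; [apply Series_Rabs|apply Series_le; [exact Hle|eexists; exact Hgeo]].
apply (ex_series_le (V := R_CompleteNormedModule) _ (fun k => B * (/ 2) ^ S n * (/ 2) ^ k)).
- intros k; unfold norm; simpl; unfold abs; simpl; rewrite Rabs_Rabsolu; apply (Hle k).
- eexists; exact Hgeo.
Qed.

Lemma is_lim_seq_sum_f_R0 (u : nat -> nat -> R) (l : nat -> R) (n : nat) :
  (forall k, is_lim_seq (fun N => u N k) (l k)) ->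
  is_lim_seq (fun N => sum_f_R0 (u N) n) (sum_f_R0 l n).
Proof.
intros H; induction n as [|n IH]; simpl; [apply H|].
apply is_lim_seq_plus'; [exact IH|apply H].
Qed.

(* Tannery's theorem. *)
Lemma is_lim_PSeries (e : nat -> nat -> R) (d : nat -> R) (x : R) :
  (forall N, entire (e N)) -> uniformly_entire e ->
  (forall n, is_lim_seq (fun N => e N n) (d n)) ->
  is_lim_seq (fun N => PSeries (e N) x) (PSeries d x).
Proof.
intros Hent He Hl; assert (Hd := entire_lim e d He Hl); assert (Hx := Rabs_pos x).
destruct (He (2 * Rabs x + 1) ltac:(lra)) as (M & B & HB).
destruct (Hd (2 * Rabs x + 1) ltac:(lra)) as (B' & HB').
apply is_lim_seq_spec; intros eps.
assert (Hpow : is_lim_seq (fun n => (Rabs B + Rabs B') * (/ 2) ^ n) 0).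
{ replace (Finite 0) with (Finite ((Rabs B + Rabs B') * 0)) by (f_equal; ring).
  apply (is_lim_seq_scal_l _ _ 0), is_lim_seq_geom; rewrite Rabs_pos_eq; lra. }
(* The truncation order [n] is fixed first, making both tails small together, uniformly in [N]; only
   then is [N] taken large for the partial sums. *)
apply is_lim_seq_spec in Hpow; destruct (Hpow (pos_div_2 eps)) as [n Hn].
specialize (Hn n (Nat.le_refl n)); simpl in Hn; rewrite Rminus_0_r in Hn.
assert (Hs := is_lim_seq_sum_f_R0 (fun N k => e N k * x ^ k) (fun k => d k * x ^ k) n
  ltac:(intros k; apply is_lim_seq_mult'; [apply Hl|apply is_lim_seq_const])).
apply is_lim_seq_spec in Hs; destruct (Hs (pos_div_2 eps)) as [M' HM']; simpl in HM'.
exists (max M M'); intros N HN.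
specialize (HM' N ltac:(lia)).
assert (T1 := PSeries_tail_bound (e N) x (2 * Rabs x + 1) B (Hent N) ltac:(lra)
  (fun k => HB N k ltac:(lia)) n).
assert (T2 := PSeries_tail_bound d x (2 * Rabs x + 1) B' Hd ltac:(lra) HB' n).
assert (Hp : 0 <= (/ 2) ^ n) by (apply pow_le; lra).
assert (B * (/ 2) ^ n <= Rabs B * (/ 2) ^ n) by (apply Rmult_le_compat_r; [exact Hp|apply Rle_abs]).
assert (B' * (/ 2) ^ n <= Rabs B' * (/ 2) ^ n) by (apply Rmult_le_compat_r; [exact Hp|apply Rle_abs]).
apply Rabs_lt_between in Hn; apply Rabs_lt_between in HM'.
apply Rabs_le_between in T1; apply Rabs_le_between in T2.
apply Rabs_lt_between; lra.
Qed.

(** * The differential equation [A g + c x g' = f] *)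

Lemma PSeries_affine_mult (e : nat -> R) (A c x : R) : entire e ->
  PSeries (fun n => (A + INR n * c) * e n) x = A * PSeries e x + c * (x * PSeries (PS_derive e) x).
Proof.
intros He.
rewrite <- PSeries_scal, <- PSeries_incr_1, <- PSeries_scal, <- PSeries_plus.
- apply PSeries_ext; intros [|n]; unfold PS_plus, PS_scal, PS_incr_1, PS_derive, scal, plus, zero;
    simpl; unfold mult; simpl; ring.
- apply (ex_pseries_scal (K := R_AbsRing) (V := R_NormedModule)); [apply Rmult_comm|apply entire_ex, He].
- apply (ex_pseries_scal (K := R_AbsRing) (V := R_NormedModule)); [apply Rmult_comm|].
  apply ex_pseries_incr_1, entire_ex, entire_derive, He.
Qed.

(* At a negative minimum of [g] on [[0, x]] one has [x g' <= 0], so [A g + c x g' < 0] there. *)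
Lemma euler_ode_nonneg (g g' : R -> R) (A c x : R) : 0 < A -> 0 < c ->
  (forall t, is_derive g t (g' t)) -> (forall t, 0 <= A * g t + c * (t * g' t)) ->
  0 <= x -> 0 <= g x.
Proof.
intros HA Hc Hg Hode Hx; apply Rnot_lt_le; intros Hneg.
destruct (continuity_ab_min g 0 x Hx) as (t & Hmin & Ht).
{ intros t _; apply derivable_continuous_pt; exists (g' t); apply is_derive_Reals, Hg. }
assert (Hgt : g t < 0) by (specialize (Hmin x ltac:(lra)); lra).
assert (Ht0 : 0 < t).
{ destruct (proj1 Ht) as [|Heq]; [assumption|].
  specialize (Hode t); rewrite <- Heq in *; nra. }
assert (Hd : g' t <= 0).
{ apply Rnot_lt_le; intros Hpos.
  assert (Hlim := proj1 (is_derive_Reals _ _ _) (Hg t)).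
  destruct (Hlim (g' t) Hpos) as [[delta Hdel] Hq]; simpl in Hq.
  (* A backward step that stays in [[0, x]]: minimality at [t] makes the difference quotient
     nonpositive, against [g' t > 0]. *)
  set (h := - Rmin (delta / 2) t).
  assert (Hh : - delta < h /\ - t <= h < 0).
  { unfold h; generalize (Rmin_l (delta / 2) t) (Rmin_r (delta / 2) t).
    assert (0 < Rmin (delta / 2) t) by (apply Rmin_glb_lt; lra); lra. }
  specialize (Hq h ltac:(lra) ltac:(rewrite Rabs_left; lra)).
  apply Rabs_lt_between in Hq.
  assert (Hm := Hmin (t + h) ltac:(lra)).
  assert ((g (t + h) - g t) / h <= 0).
  { unfold Rdiv; assert (/ h < 0) by (apply Rinv_lt_0_compat; lra); nra. }
  lra. }
specialize (Hode t).
assert (t * g' t <= 0) by nra.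
nra.
Qed.

(* [t ^ k * g] is nondecreasing on [[0, x]] for any integer [k >= A / c]. *)
Lemma euler_ode_pos (g g' : R -> R) (A c x : R) : 0 < A -> 0 < c ->
  (forall t, is_derive g t (g' t)) -> (forall t, 0 <= A * g t + c * (t * g' t)) ->
  0 < g 0 -> 0 <= x -> 0 < g x.
Proof.
intros HA Hc Hg Hode Hg0 [Hx| <-]; [|exact Hg0].
assert (Hnn : forall t, 0 <= t -> 0 <= g t)
  by (intros t; apply (euler_ode_nonneg g g' A c t HA Hc Hg Hode)).
assert (Hcont : continuity_pt g 0)
  by (apply derivable_continuous_pt; exists (g' 0); apply is_derive_Reals, Hg).
destruct (Hcont (g 0) Hg0) as (delta & Hdel & Hnear).
(* [t ^ (k + 1) * g] vanishes at 0, so the comparison starts at a point [s > 0] where continuity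
   keeps [g] positive. *)
set (s := Rmin (delta / 2) (x / 2)).
assert (Hs : 0 < s /\ s <= delta / 2 /\ s <= x / 2).
{ unfold s; generalize (Rmin_l (delta / 2) (x / 2)) (Rmin_r (delta / 2) (x / 2)).
  assert (0 < Rmin (delta / 2) (x / 2)) by (apply Rmin_glb_lt; lra); lra. }
assert (Hgs : 0 < g s).
{ specialize (Hnear s).
  assert (Hdist : Rabs (g s - g 0) < g 0).
  { apply Hnear; split; [split; [exact I|lra]|].
    simpl; unfold R_dist; rewrite Rabs_pos_eq; lra. }
  apply Rabs_lt_between in Hdist; lra. }
destruct (nfloor_ex (A / c)) as [k Hk]; [apply Rlt_le, Rdiv_lt_0_compat; assumption|].
destruct (MVT_cor2 (fun t => t ^ S k * g t)
  (fun t => INR (S k) * t ^ k * g t + t ^ S k * g' t) s x ltac:(lra)) as (t & Heq & Ht).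
{ intros t _; apply derivable_pt_lim_mult.
  - exact (derivable_pt_lim_pow t (S k)).
  - apply is_derive_Reals, Hg. }
assert (Hder : 0 <= INR (S k) * t ^ k * g t + t ^ S k * g' t).
{ simpl (t ^ S k).
  replace (INR (S k) * t ^ k * g t + t * t ^ k * g' t) with (t ^ k * (INR (S k) * g t + t * g' t)) by ring.
  apply Rmult_le_pos; [apply pow_le; lra|].
  assert (HA' : A <= INR (S k) * c).
  { rewrite S_INR; destruct Hk as [_ Hk]; apply (Rmult_lt_compat_r c) in Hk; [|exact Hc].
    unfold Rdiv in Hk; rewrite Rmult_assoc, Rinv_l in Hk by lra; lra. }
  specialize (Hode t); assert (Hgt := Hnn t ltac:(lra)).
  apply (Rmult_le_reg_l c); [exact Hc|].
  assert (A * g t <= INR (S k) * c * g t) by (apply Rmult_le_compat_r; lra).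
  lra. }
assert (0 < s ^ S k * g s) by (apply Rmult_lt_0_compat; [apply pow_lt; lra|exact Hgs]).
assert (0 < x ^ S k) by (apply pow_lt; lra).
assert (0 <= (INR (S k) * t ^ k * g t + t ^ S k * g' t) * (x - s)) by (apply Rmult_le_pos; lra).
assert (0 < x ^ S k * g x) by lra.
destruct (Hnn x ltac:(lra)) as [|Hz]; [assumption|].
rewrite <- Hz in *; lra.
Qed.

Lemma is_derive_PSeries_entire (d : nat -> R) (x : R) : entire d ->
  is_derive (PSeries d) x (PSeries (PS_derive d) x).
Proof. intros Hd; apply is_derive_PSeries, entire_radius, Hd. Qed.

(** [x g'] is compatible with [x -> - x], so reflection reduces negative arguments to the results on
    the positive half-line. *)
Lemma is_derive_reflect (g g' : R -> R) (t : R) :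
  (forall t, is_derive g t (g' t)) -> is_derive (fun t => g (- t)) t (- g' (- t)).
Proof.
intros Hg.
replace (- g' (- t)) with (scal (- 1) (g' (- t))) by (unfold scal; simpl; unfold mult; simpl; ring).
apply (is_derive_comp g Ropp); [apply Hg|].
auto_derive; [exact I|ring].
Qed.

Definition divided (A c : R) (d : nat -> R) (n : nat) : R := d n * / (A + INR n * c).

Lemma affine_pos (A c : R) (n : nat) : 0 < A -> 0 < c -> 0 < A + INR n * c.
Proof. intros HA Hc; assert (H := pos_INR n); nra. Qed.

Lemma entire_divided (A c : R) (d : nat -> R) : 0 < A -> 0 < c -> entire d -> entire (divided A c d).
Proof.
intros HA Hc Hd; apply (entire_mult d (fun n => / (A + INR n * c)) (/ A)); [exact Hd|].
intros n; assert (Hn := pos_INR n); assert (H := affine_pos A c n HA Hc).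
rewrite Rabs_pos_eq by (apply Rlt_le, Rinv_0_lt_compat, H).
apply Rinv_le_contravar; [exact HA|nra].
Qed.

Lemma divided_ode (A c : R) (d : nat -> R) (x : R) : 0 < A -> 0 < c -> entire d ->
  PSeries d x = A * PSeries (divided A c d) x + c * (x * PSeries (PS_derive (divided A c d)) x).
Proof.
intros HA Hc Hd; rewrite <- PSeries_affine_mult by (apply entire_divided; assumption).
apply PSeries_ext; intros n; unfold divided; assert (H := affine_pos A c n HA Hc); field; lra.
Qed.

Lemma divided_nonneg (A c : R) (d : nat -> R) : 0 < A -> 0 < c -> entire d ->
  (forall x, 0 <= PSeries d x) -> forall x, 0 <= PSeries (divided A c d) x.
Proof.
intros HA Hc Hd Hnn x.
assert (HD : forall t, is_derive (PSeries (divided A c d)) t (PSeries (PS_derive (divided A c d)) t))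
  by (intros t; apply is_derive_PSeries_entire, entire_divided; assumption).
destruct (Rle_dec 0 x) as [Hx|Hx].
- apply (euler_ode_nonneg _ (PSeries (PS_derive (divided A c d))) A c); try assumption.
  intros t; rewrite <- divided_ode by assumption; apply Hnn.
- replace x with (- - x) by ring.
  apply (euler_ode_nonneg (fun t => PSeries (divided A c d) (- t))
    (fun t => - PSeries (PS_derive (divided A c d)) (- t)) A c (- x) HA Hc); [| |lra].
  + intros t; apply is_derive_reflect, HD.
  + intros t; specialize (Hnn (- t)); rewrite (divided_ode A c d) in Hnn by assumption; lra.
Qed.

Lemma divided_pos (A c : R) (d : nat -> R) : 0 < A -> 0 < c -> entire d ->
  (forall x, 0 <= PSeries d x) -> 0 < d O -> forall x, 0 < PSeries (divided A c d) x.
Proof.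
intros HA Hc Hd Hnn Hd0 x.
assert (HD : forall t, is_derive (PSeries (divided A c d)) t (PSeries (PS_derive (divided A c d)) t))
  by (intros t; apply is_derive_PSeries_entire, entire_divided; assumption).
assert (H0 : 0 < PSeries (divided A c d) 0).
{ rewrite PSeries_0; unfold divided; simpl; rewrite Rmult_0_l, Rplus_0_r.
  apply Rmult_lt_0_compat; [exact Hd0|apply Rinv_0_lt_compat, HA]. }
destruct (Rle_dec 0 x) as [Hx|Hx].
- apply (euler_ode_pos _ (PSeries (PS_derive (divided A c d))) A c); try assumption.
  intros t; rewrite <- divided_ode by assumption; apply Hnn.
- replace x with (- - x) by ring.
  apply (euler_ode_pos (fun t => PSeries (divided A c d) (- t))
    (fun t => - PSeries (PS_derive (divided A c d)) (- t)) A c (- x) HA Hc); [| | |lra].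
  + intros t; apply is_derive_reflect, HD.
  + intros t; specialize (Hnn (- t)); rewrite (divided_ode A c d) in Hnn by assumption; lra.
  + rewrite Ropp_0; exact H0.
Qed.

(** * Convexity and Jensen's inequality *)

(** The averaging operators have [p = q = i]; distinct [p] and [q] arise on second derivatives. *)
Definition homographic (p a q b : R) (d : nat -> R) (n : nat) : R :=
  d n * ((p + INR n * a) / (q + INR n * b)).

(** Partial fractions in [n]: the constant [a / b] is the atom at 1, and the remainder is a multiple
    of [divided q b]. *)
Lemma homographic_split (p a q b : R) (d : nat -> R) (n : nat) : 0 < q -> 0 < b ->
  homographic p a q b d n =
  PS_plus (PS_scal (a / b) d) (PS_scal (p - a * q / b) (divided q b d)) n.
Proof.
intros Hq Hb; assert (H := affine_pos q b n Hq Hb).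
unfold homographic, divided, PS_plus, PS_scal, plus, scal; simpl; unfold mult; simpl.
field; lra.
Qed.

Lemma PSeries_homographic (p a q b : R) (d : nat -> R) (x : R) : 0 < q -> 0 < b -> entire d ->
  PSeries (homographic p a q b d) x =
  a / b * PSeries d x + (p - a * q / b) * PSeries (divided q b d) x.
Proof.
intros Hq Hb Hd; rewrite <- !PSeries_scal, <- PSeries_plus.
- apply PSeries_ext; intros n; apply homographic_split; assumption.
- apply (ex_pseries_scal (K := R_AbsRing) (V := R_NormedModule)); [apply Rmult_comm|apply entire_ex, Hd].
- apply (ex_pseries_scal (K := R_AbsRing) (V := R_NormedModule)); [apply Rmult_comm|].
  apply entire_ex, entire_divided; assumption.
Qed.

Lemma entire_homographic (p a q b : R) (d : nat -> R) :
  0 < q -> 0 < b -> 0 <= p -> 0 <= a -> entire d -> entire (homographic p a q b d).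
Proof.
intros Hq Hb Hp Ha Hd.
apply (entire_mult d (fun n => (p + INR n * a) / (q + INR n * b)) (p / q + a / b)); [exact Hd|].
intros n; assert (Hn := pos_INR n); assert (H := affine_pos q b n Hq Hb).
assert (0 <= INR n * a) by (apply Rmult_le_pos; assumption).
assert (0 <= INR n * b) by (apply Rmult_le_pos; lra).
rewrite Rabs_pos_eq by (apply Rdiv_le_0_compat; lra).
apply (Rmult_le_reg_r (q + INR n * b)); [exact H|].
unfold Rdiv at 1; rewrite Rmult_assoc, Rinv_l, Rmult_1_r by lra.
replace ((p / q + a / b) * (q + INR n * b))
  with (p + INR n * a + (p / q * (INR n * b) + a / b * q)) by (field; lra).
assert (0 <= p / q) by (apply Rdiv_le_0_compat; lra).
assert (0 <= a / b) by (apply Rdiv_le_0_compat; lra).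
assert (0 <= p / q * (INR n * b)) by (apply Rmult_le_pos; assumption).
assert (0 <= a / b * q) by (apply Rmult_le_pos; lra).
lra.
Qed.

Lemma homographic_coef_nonneg (p a q b : R) : 0 < b -> a * q <= p * b -> 0 <= p - a * q / b.
Proof.
intros Hb H; apply (Rmult_le_reg_r b); [exact Hb|].
replace ((p - a * q / b) * b) with (p * b - a * q) by (field; lra); lra.
Qed.

(** The contribution of the atom is kept rather than bounded below by 0: in Jensen's inequality it
    is the source of strictness. *)
Lemma homographic_ge (p a q b : R) (d : nat -> R) : 0 < q -> 0 < b -> a * q <= p * b ->
  entire d -> (forall x, 0 <= PSeries d x) ->
  forall x, a / b * PSeries d x <= PSeries (homographic p a q b d) x.
Proof.
intros Hq Hb Hpq Hd Hnn x; rewrite PSeries_homographic by assumption.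
assert (H := homographic_coef_nonneg p a q b Hb Hpq).
assert (H' := divided_nonneg q b d Hq Hb Hd Hnn x).
generalize (Rmult_le_pos _ _ H H'); lra.
Qed.

Lemma homographic_pos (p a q b : R) (d : nat -> R) : 0 < q -> 0 < b -> 0 <= a -> a * q < p * b ->
  entire d -> (forall x, 0 <= PSeries d x) -> 0 < d O ->
  forall x, 0 < PSeries (homographic p a q b d) x.
Proof.
intros Hq Hb Ha Hpq Hd Hnn Hd0 x; rewrite PSeries_homographic by assumption.
assert (H : 0 < p - a * q / b).
{ apply (Rmult_lt_reg_r b); [exact Hb|].
  replace ((p - a * q / b) * b) with (p * b - a * q) by (field; lra); lra. }
assert (H' := divided_pos q b d Hq Hb Hd Hnn Hd0 x).
assert (0 <= a / b) by (apply Rdiv_le_0_compat; lra).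
generalize (Rmult_lt_0_compat _ _ H H') (Rmult_le_pos _ _ H0 (Hnn x)); lra.
Qed.

Definition PS_derive2 (d : nat -> R) : nat -> R := PS_derive (PS_derive d).

Lemma entire_derive2 (d : nat -> R) : entire d -> entire (PS_derive2 d).
Proof. intros Hd; apply entire_derive, entire_derive, Hd. Qed.

(** Differentiating twice shifts [n] by 2, so the operator acts on second derivatives as another
    operator of the same family. *)
Lemma PS_derive2_homographic (p a q b : R) (d : nat -> R) (n : nat) :
  PS_derive2 (homographic p a q b d) n =
  homographic (p + 2 * a) a (q + 2 * b) b (PS_derive2 d) n.
Proof.
unfold PS_derive2, PS_derive, homographic.
replace (p + INR (S (S n)) * a) with (p + 2 * a + INR n * a) by (rewrite !S_INR; ring).
replace (q + INR (S (S n)) * b) with (q + 2 * b + INR n * b) by (rewrite !S_INR; ring).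
ring.
Qed.

Definition convex_entire (d : nat -> R) : Prop :=
  entire d /\ forall x, 0 <= PSeries (PS_derive2 d) x.

Lemma convex_homographic (p a b : R) (d : nat -> R) : 0 < p -> 0 <= a -> a <= b -> 0 < b ->
  convex_entire d -> convex_entire (homographic p a p b d).
Proof.
intros Hp Ha Hab Hb [Hd Hnn]; split; [apply entire_homographic; try assumption; lra|].
intros x; rewrite (PSeries_ext _ _ x (PS_derive2_homographic p a p b d)).
assert (0 <= a / b) by (apply Rdiv_le_0_compat; lra).
assert (H' := Hnn x).
apply Rle_trans with (a / b * PSeries (PS_derive2 d) x); [apply Rmult_le_pos; assumption|].
apply homographic_ge; [lra|exact Hb| |apply entire_derive2, Hd|exact Hnn].
(* The required sign is that of [(p + 2 a) b - a (p + 2 b) = p (b - a)]. *)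
assert (a * p <= b * p) by (apply Rmult_le_compat_r; lra); lra.
Qed.

Lemma strictly_convex_homographic (p a b : R) (d : nat -> R) : 0 < p -> 0 <= a -> a < b ->
  convex_entire d -> 0 < d 2%nat ->
  forall x, 0 < PSeries (PS_derive2 (homographic p a p b d)) x.
Proof.
intros Hp Ha Hab [Hd Hnn] Hd2 x.
rewrite (PSeries_ext _ _ x (PS_derive2_homographic p a p b d)).
apply homographic_pos; try lra; [|apply entire_derive2, Hd|exact Hnn|].
- assert (a * p < b * p) by (apply Rmult_lt_compat_r; lra); lra.
- unfold PS_derive2, PS_derive; simpl; lra.
Qed.

(** Two applications of the mean value theorem; [k] is a product of two lengths of equal sign, and
    only its positivity matters later. *)
Lemma PSeries_taylor2 (d : nat -> R) (p y : R) : entire d -> p <> y ->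
  exists k z, 0 < k /\
    PSeries d y = PSeries d p + PSeries (PS_derive d) p * (y - p) + k * PSeries (PS_derive2 d) z.
Proof.
intros Hd Hpy.
assert (H1 : forall t, derivable_pt_lim (PSeries d) t (PSeries (PS_derive d) t))
  by (intros t; apply is_derive_Reals, is_derive_PSeries_entire, Hd).
assert (H2 : forall t, derivable_pt_lim (PSeries (PS_derive d)) t (PSeries (PS_derive2 d) t))
  by (intros t; apply is_derive_Reals, is_derive_PSeries_entire, entire_derive, Hd).
destruct (Rlt_or_le p y) as [Hlt|Hle].
- destruct (MVT_cor2 _ _ p y Hlt (fun t _ => H1 t)) as (c & Hc & Hpc).
  destruct (MVT_cor2 _ _ p c (proj1 Hpc) (fun t _ => H2 t)) as (z & Hz & Hpz).
  exists ((c - p) * (y - p)), z; split; [apply Rmult_lt_0_compat; lra|].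
  replace (PSeries (PS_derive d) p)
    with (PSeries (PS_derive d) c - PSeries (PS_derive2 d) z * (c - p)) by lra.
  lra.
- assert (Hlt : y < p) by lra.
  destruct (MVT_cor2 _ _ y p Hlt (fun t _ => H1 t)) as (c & Hc & Hpc).
  destruct (MVT_cor2 _ _ c p (proj2 Hpc) (fun t _ => H2 t)) as (z & Hz & Hpz).
  exists ((p - c) * (p - y)), z; split; [apply Rmult_lt_0_compat; lra|].
  replace (PSeries (PS_derive d) p)
    with (PSeries (PS_derive d) c + PSeries (PS_derive2 d) z * (p - c)) by lra.
  lra.
Qed.

Definition affine_coef (u v : R) (n : nat) : R :=
  match n with O => u | 1%nat => v | _ => 0 end.

Lemma entire_affine (u v : R) : entire (affine_coef u v).
Proof.
intros r Hr; exists (Rabs u + Rabs v * r); intros n.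
assert (Hu := Rabs_pos u); assert (Hv := Rmult_le_pos _ _ (Rabs_pos v) (Rlt_le _ _ Hr)).
destruct n as [|[|n]]; simpl; [lra|lra|].
rewrite Rabs_R0; lra.
Qed.

Lemma PSeries_affine (u v x : R) : PSeries (affine_coef u v) x = u + v * x.
Proof.
rewrite (PSeries_decr_n _ 1 x) by apply entire_ex, entire_affine.
rewrite (PSeries_ext (PS_decr_n (affine_coef u v) 2) (fun _ => 0)) by reflexivity.
rewrite PSeries_const_0; simpl; ring.
Qed.

Lemma entire_minus (d e : nat -> R) : entire d -> entire e -> entire (PS_minus d e).
Proof.
intros Hd He r Hr; destruct (Hd r Hr) as [B HB]; destruct (He r Hr) as [B' HB'].
exists (B + B'); intros n; unfold PS_minus, PS_plus, PS_opp, plus, opp; simpl.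
apply Rle_trans with ((Rabs (d n) + Rabs (e n)) * r ^ n).
- apply Rmult_le_compat_r; [apply pow_le; lra|].
  rewrite <- (Rabs_Ropp (e n)); apply Rabs_triang.
- rewrite Rmult_plus_distr_r; apply Rplus_le_compat; auto.
Qed.

(* Positivity of [homographic p a p b], applied to the series minus its tangent at the mean [y]. *)
Lemma homographic_jensen (p a b : R) (d : nat -> R) (x : R) :
  0 < p -> 0 <= a -> a <= b -> 0 < b -> convex_entire d ->
  let y := (p + a) / (p + b) * x in
  PSeries d y + a / b * (PSeries d x - PSeries d y - PSeries (PS_derive d) y * (x - y))
  <= PSeries (homographic p a p b d) x.
Proof.
intros Hp Ha Hab Hb [Hd Hnn] y.
set (v := PSeries (PS_derive d) y); set (u := PSeries d y - v * y).
set (l := affine_coef u v).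
assert (Hl : entire l) by apply entire_affine.
assert (Hdl : entire (PS_minus d l)) by (apply entire_minus; assumption).
assert (Heq : forall t, PSeries (PS_minus d l) t = PSeries d t - (u + v * t)).
{ intros t; rewrite PSeries_minus by (apply entire_ex; assumption).
  unfold l; rewrite PSeries_affine; reflexivity. }
assert (Hpos : forall t, 0 <= PSeries (PS_minus d l) t).
{ intros t; rewrite Heq; unfold u.
  destruct (Req_dec y t) as [<-|Hyt]; [lra|].
  destruct (PSeries_taylor2 d y t Hd Hyt) as (k & z & Hk & ->); fold v.
  generalize (Rmult_le_pos _ _ (Rlt_le _ _ Hk) (Hnn z)); lra. }
assert (Hge := homographic_ge p a p b (PS_minus d l) Hp Hb ltac:(nra) Hdl Hpos x).
(* The operator fixes constants and multiplies [x] by [(p + a) / (p + b)], so it sends the tangent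
   [u + v x] to [u + v y], whose value is [PSeries d y]. *)
assert (HT : PSeries (homographic p a p b (PS_minus d l)) x
             = PSeries (homographic p a p b d) x - (u + v * y)).
{ replace (u + v * y) with (PSeries (affine_coef u (v * ((p + a) / (p + b)))) x)
    by (rewrite PSeries_affine; unfold y; field; lra).
  rewrite <- PSeries_minus by (apply entire_ex; try apply entire_affine;
    apply entire_homographic; try assumption; lra).
  apply PSeries_ext; intros [|[|n]];
    unfold homographic, PS_minus, PS_plus, PS_opp, plus, opp, l; simpl affine_coef; simpl;
    try (rewrite !Rmult_1_l); field; try lra.
  assert (Hn := pos_INR (S (S n))); simpl in Hn.
  assert (0 <= (match n with O => 1 | S _ => INR n + 1 end + 1) * b) by (apply Rmult_le_pos; lra).
  lra. }
rewrite HT, Heq in Hge; unfold u in *; lra.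
Qed.

(** * Passage to the limit *)

(** The product of [(i + s) / (i + t)] for [i] from 2 to [N + 1]: the factor [i = 1] is left out. *)
Fixpoint tail_quotient (N : nat) (s t : R) : R :=
  match N with
  | O => 1
  | S k => tail_quotient k s t * ((INR (S (S k)) + s) / (INR (S (S k)) + t))
  end.

Lemma rising_quotient (N : nat) (s t : R) : 0 <= s -> 0 <= t ->
  rising (S N) s / rising (S N) t = tail_quotient N s t * ((1 + s) / (1 + t)).
Proof.
intros Hs Ht; induction N as [|N IH].
- simpl; field; lra.
- change (rising (S (S N)) s) with (rising (S N) s * (1 + s / INR (S (S N)))).
  change (rising (S (S N)) t) with (rising (S N) t * (1 + t / INR (S (S N)))).
  cbn [tail_quotient].
  assert (Hr := rising_pos (S N) t Ht); assert (Hn := INR_S_pos (S N)).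
  replace (rising (S N) s * (1 + s / INR (S (S N))) / (rising (S N) t * (1 + t / INR (S (S N)))))
    with (rising (S N) s / rising (S N) t * ((INR (S (S N)) + s) / (INR (S (S N)) + t)))
    by (field; repeat split; lra).
  rewrite IH; field; lra.
Qed.

Definition iterated (N : nat) (a b : R) (d : nat -> R) (n : nat) : R :=
  d n * tail_quotient N (INR n * a) (INR n * b).

Lemma convex_entire_ext (d e : nat -> R) :
  (forall n, d n = e n) -> convex_entire d -> convex_entire e.
Proof.
intros H [Hd Hnn]; split.
- intros r Hr; destruct (Hd r Hr) as [B HB]; exists B; intros n; rewrite <- H; apply HB.
- intros x; rewrite <- (PSeries_ext (PS_derive2 d)); [apply Hnn|].
  intros n; unfold PS_derive2, PS_derive; rewrite H; reflexivity.
Qed.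

Lemma iterated_succ (N : nat) (a b : R) (d : nat -> R) (n : nat) :
  homographic (INR (S (S N))) a (INR (S (S N))) b (iterated N a b d) n = iterated (S N) a b d n.
Proof. unfold homographic, iterated; cbn [tail_quotient]; ring. Qed.

Lemma convex_iterated (N : nat) (a b : R) (d : nat -> R) : 0 <= a -> a <= b -> 0 < b ->
  convex_entire d -> convex_entire (iterated N a b d).
Proof.
intros Ha Hab Hb Hd; induction N as [|N IH].
- apply (convex_entire_ext d); [|exact Hd]; intros n; unfold iterated; simpl; ring.
- apply (convex_entire_ext _ _ (iterated_succ N a b d)).
  apply convex_homographic; try assumption; apply INR_S_pos.
Qed.

(** The means of the successive operators multiply. At each stage the extra term of
    [homographic_jensen] is nonnegative by convexity and is dropped. *)
Lemma iterated_jensen (N : nat) (a b : R) (d : nat -> R) : 0 <= a -> a <= b -> 0 < b ->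
  convex_entire d -> forall x, PSeries d (tail_quotient N a b * x) <= PSeries (iterated N a b d) x.
Proof.
intros Ha Hab Hb Hd; induction N as [|N IH]; intros x.
- simpl; rewrite Rmult_1_l; right; apply PSeries_ext; intros n; unfold iterated; simpl; ring.
- rewrite <- (PSeries_ext _ _ x (iterated_succ N a b d)).
  cbn [tail_quotient]; set (p := INR (S (S N))).
  assert (HC := convex_iterated N a b d Ha Hab Hb Hd).
  assert (HJ := homographic_jensen p a b (iterated N a b d) x (INR_S_pos _) Ha Hab Hb HC).
  cbv zeta in HJ; rewrite Rmult_assoc; set (y := (p + a) / (p + b) * x) in *.
  apply Rle_trans with (1 := IH y), Rle_trans with (2 := HJ).
  assert (Hab' : 0 <= a / b) by (apply Rdiv_le_0_compat; lra).
  destruct (Req_dec y x) as [->|Hyx]; [lra|].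
  destruct (PSeries_taylor2 _ y x (proj1 HC) Hyx) as (k & z & Hk & ->).
  assert (0 <= k * PSeries (PS_derive2 (iterated N a b d)) z)
    by (apply Rmult_le_pos; [lra|apply (proj2 HC)]).
  nra.
Qed.

Definition dilate (c : R) (d : nat -> R) (n : nat) : R := d n * c ^ n.

Lemma PSeries_dilate (c : R) (d : nat -> R) (x : R) : PSeries (dilate c d) x = PSeries d (c * x).
Proof. apply Series_ext; intros n; unfold dilate; rewrite Rpow_mult_distr; ring. Qed.

Lemma convex_dilate (c : R) (d : nat -> R) : 0 < c -> convex_entire d -> convex_entire (dilate c d).
Proof.
intros Hc [Hd Hnn]; split.
- intros r Hr; destruct (Hd (c * r) ltac:(apply Rmult_lt_0_compat; assumption)) as [B HB].
  exists B; intros n; unfold dilate.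
  rewrite Rabs_mult, (Rabs_pos_eq (c ^ n)), Rmult_assoc, <- Rpow_mult_distr by (apply pow_le; lra).
  apply HB.
- intros x.
  rewrite (PSeries_ext _ (PS_scal (c ^ 2) (dilate c (PS_derive2 d)))).
  + rewrite PSeries_scal, PSeries_dilate; apply Rmult_le_pos; [apply pow2_ge_0|apply Hnn].
  + intros n; unfold PS_derive2, PS_derive, PS_scal, dilate, scal; simpl; unfold mult; simpl; ring.
Qed.

(** The dilation multiplies the [n]-th coefficient by [(N + 1) ^ (n (b - a))], the power in Euler's
    formula for the quotient of Gamma values. *)
Definition rescaled (N : nat) (a b : R) (d : nat -> R) : nat -> R :=
  dilate (Rpower (INR (S N)) (b - a)) (iterated N a b d).

Lemma Rpower_pow_mult (x s : R) (n : nat) : Rpower x s ^ n = Rpower x (INR n * s).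
Proof.
rewrite <- Rpower_pow by apply exp_pos; rewrite Rpower_mult; f_equal; ring.
Qed.

(** The factor [(1 + n b) / (1 + n a)] compensates for the omitted index [i = 1]. *)
Lemma rescaled_euler (N : nat) (a b : R) (d : nat -> R) (n : nat) : 0 <= a -> 0 <= b ->
  rescaled N a b d n =
  d n * ((1 + INR n * b) / (1 + INR n * a)) * (euler (S N) (INR n * a) / euler (S N) (INR n * b)).
Proof.
intros Ha Hb; assert (Hn := pos_INR n).
assert (Hna := Rmult_le_pos _ _ Hn Ha); assert (Hnb := Rmult_le_pos _ _ Hn Hb).
unfold rescaled, dilate, iterated, euler; rewrite Rpower_pow_mult.
replace (INR n * (b - a)) with (INR n * b + - (INR n * a)) by ring.
rewrite Rpower_plus, Rpower_Ropp.
assert (HQ := rising_quotient N _ _ Hna Hnb).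
assert (Hr := rising_pos (S N) _ Hnb).
assert (Ea : 0 < Rpower (INR (S N)) (INR n * a)) by apply exp_pos.
assert (Eb : 0 < Rpower (INR (S N)) (INR n * b)) by apply exp_pos.
replace (rising (S N) (INR n * a) / Rpower (INR (S N)) (INR n * a) /
         (rising (S N) (INR n * b) / Rpower (INR (S N)) (INR n * b)))
  with (rising (S N) (INR n * a) / rising (S N) (INR n * b) *
        (Rpower (INR (S N)) (INR n * b) / Rpower (INR (S N)) (INR n * a))) by (field; lra).
rewrite HQ; field; lra.
Qed.

Lemma rising_le_pow (N : nat) (s : R) : 0 <= s -> rising N s <= (1 + s) ^ N.
Proof.
intros Hs; induction N as [|N IH]; cbn [rising pow]; [lra|].
assert (Hr := rising_pos N s Hs); rewrite Rmult_comm.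
assert (Hq : 0 <= s / INR (S N) <= s).
{ split; [apply Rdiv_le_0_compat; [exact Hs|apply INR_S_pos]|].
  apply (Rmult_le_reg_r (INR (S N))); [apply INR_S_pos|].
  unfold Rdiv; rewrite Rmult_assoc, Rinv_l, Rmult_1_r by (apply not_0_INR; lia).
  rewrite <- (Rmult_1_r s) at 1; apply Rmult_le_compat_l; [exact Hs|].
  rewrite S_INR; generalize (pos_INR N); lra. }
apply Rmult_le_compat; lra.
Qed.

Lemma pow_le_geom (k : nat) : exists B, forall n, (1 + INR n) ^ k <= B * 2 ^ n.
Proof.
destruct k as [|k].
- exists 1; intros n; simpl; rewrite Rmult_1_l; apply pow_R1_Rle; lra.
- assert (HK := INR_S_pos k); set (K := INR (S k)) in *.
  assert (Hln : 0 < ln 2) by (rewrite <- ln_1; apply ln_increasing; lra).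
  (* [u <= exp u] at [u = (1 + n) ln 2 / K], raised to the power [K], has right-hand side
     [2 ^ (n + 1)]; hence the factor 2. *)
  exists ((K / ln 2) ^ S k * 2); intros n; assert (Hn := pos_INR n).
  replace (1 + INR n) with (K / ln 2 * ((1 + INR n) * ln 2 / K)) by (field; lra).
  rewrite Rpow_mult_distr, Rmult_assoc; apply Rmult_le_compat_l.
  { apply pow_le, Rdiv_le_0_compat; lra. }
  apply Rle_trans with (exp ((1 + INR n) * ln 2 / K) ^ S k).
  + apply pow_incr; split.
    * apply Rdiv_le_0_compat; [apply Rmult_le_pos|]; lra.
    * generalize (exp_ineq1_le ((1 + INR n) * ln 2 / K)); lra.
  + rewrite <- Rpower_pow by apply exp_pos; unfold Rpower; rewrite ln_exp; fold K.
    replace (K * ((1 + INR n) * ln 2 / K)) with (ln 2 + INR n * ln 2) by (field; lra).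
    rewrite exp_plus, exp_ln by lra; right; f_equal.
    rewrite <- (Rpower_pow n 2) by lra; reflexivity.
Qed.

(** Monotonicity in [N] reduces to [N = M]. There the numerator grows polynomially in [n], while the
    denominator is at least [(2 r) ^ n]. *)
Lemma euler_uniform_bound (a r : R) : 0 < a <= 1 -> 0 < r ->
  exists M B, forall N n, (M <= N)%nat -> euler (S N) (INR n * a) * r ^ n <= B.
Proof.
intros Ha Hr.
(* [M] is chosen so that [(M + 1) ^ a >= 2 r]. *)
destruct (nfloor_ex (Rpower (2 * r) (/ a))) as [M [_ HM]]; [apply Rlt_le, exp_pos|].
destruct (pow_le_geom (S M)) as [B HB]; exists M, B; intros N n HN; assert (Hn := pos_INR n).
assert (Hna : 0 <= INR n * a) by (apply Rmult_le_pos; lra).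
apply Rle_trans with (euler (S M) (INR n * a) * r ^ n).
{ apply Rmult_le_compat_r; [apply pow_le; lra|apply euler_antitone; assumption]. }
unfold euler; rewrite <- Rpower_pow_mult; rewrite S_INR.
set (R1 := Rpower (INR M + 1) a).
assert (HR1 : 2 * r <= R1).
{ replace (2 * r) with (Rpower (Rpower (2 * r) (/ a)) a).
  - apply Rle_Rpower_l; [lra|]; split; [apply exp_pos|lra].
  - rewrite Rpower_mult, Rinv_l, Rpower_1 by lra; reflexivity. }
assert (HP : 0 < R1 ^ n) by (apply pow_lt; lra).
apply (Rmult_le_reg_r (R1 ^ n)); [exact HP|].
replace (rising (S M) (INR n * a) / R1 ^ n * r ^ n * R1 ^ n)
  with (rising (S M) (INR n * a) * r ^ n) by (field; lra).
assert (H2 : 2 ^ n * r ^ n <= R1 ^ n) by (rewrite <- Rpow_mult_distr; apply pow_incr; lra).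
assert (HB0 : 0 <= B).
{ specialize (HB O); simpl in HB; rewrite Rplus_0_r, pow1 in HB; lra. }
assert (Hrn : 0 < r ^ n) by (apply pow_lt, Hr).
apply Rle_trans with (B * 2 ^ n * r ^ n).
- apply Rmult_le_compat_r; [lra|].
  apply Rle_trans with (1 := rising_le_pow _ _ Hna), Rle_trans with (2 := HB n).
  apply pow_incr; split; [lra|].
  apply Rplus_le_compat_l; rewrite <- (Rmult_1_r (INR n)) at 2; apply Rmult_le_compat_l; lra.
- rewrite Rmult_assoc; apply Rmult_le_compat_l; assumption.
Qed.

(** * Mittag-Leffler functions *)

Definition ml_coef (a : R) (n : nat) : R := / Gamma (1 + INR n * a).

Lemma MittagLeffler_PSeries (a z : R) : MittagLeffler a z = PSeries (ml_coef a) z.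
Proof. apply Series_ext; intros n; unfold ml_coef, Rdiv; ring. Qed.

Lemma ml_coef_pos (a : R) (n : nat) : 0 <= a -> 0 < ml_coef a n.
Proof.
intros Ha; apply Rinv_0_lt_compat, Gamma_spec, Rmult_le_pos; [apply pos_INR|exact Ha].
Qed.

Lemma entire_ml_coef (a : R) : 0 < a <= 1 -> entire (ml_coef a).
Proof.
intros Ha r Hr; destruct (euler_uniform_bound a r Ha Hr) as (M & B & HB); exists B; intros n.
rewrite Rabs_pos_eq by (apply Rlt_le, ml_coef_pos; lra).
apply Rle_trans with (2 := HB M n (Nat.le_refl M)).
apply Rmult_le_compat_r; [apply pow_le; lra|].
apply inv_Gamma_le_euler, Rmult_le_pos; [apply pos_INR|lra].
Qed.

(** The rescaled coefficient is [v n * euler (S N) (n a)] times [ml_coef b n / euler (S N) (n b)];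
    the latter lies in [(0, 1]] and tends to 1, so [euler_uniform_bound] dominates. The weight [v]
    allows the operator [i = 1] to be placed on either side of the limit. *)
Lemma rescaled_limit (a b K : R) (v d : nat -> R) : 0 < a <= 1 -> a <= b ->
  (forall n, Rabs (v n) <= K) ->
  (forall n, d n = v n * ((1 + INR n * a) / (1 + INR n * b)) * ml_coef b n) ->
  uniformly_entire (fun N => rescaled N a b d) /\
  (forall n, is_lim_seq (fun N => rescaled N a b d n) (v n * ml_coef a n)).
Proof.
intros Ha Hab Hv Hd.
assert (Heq : forall N n, rescaled N a b d n =
  v n * (euler (S N) (INR n * a) * (ml_coef b n / euler (S N) (INR n * b)))).
{ intros N n; assert (Hn := pos_INR n); rewrite rescaled_euler, Hd by lra.
  assert (0 <= INR n * a) by (apply Rmult_le_pos; lra).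
  assert (Hnb : 0 <= INR n * b) by (apply Rmult_le_pos; lra).
  assert (He := euler_pos (S N) _ Hnb); field; lra. }
split.
- intros r Hr; destruct (euler_uniform_bound a r Ha Hr) as (M & B & HB).
  exists M, (K * B); intros N n HN; rewrite Heq, Rabs_mult, Rmult_assoc.
  assert (Hn := pos_INR n).
  assert (Hna : 0 <= INR n * a) by (apply Rmult_le_pos; lra).
  assert (Hnb : 0 <= INR n * b) by (apply Rmult_le_pos; lra).
  assert (Ea := euler_pos (S N) _ Hna); assert (Eb := euler_pos (S N) _ Hnb).
  assert (Hml : 0 < ml_coef b n) by (apply ml_coef_pos; lra).
  assert (Hq : 0 < ml_coef b n / euler (S N) (INR n * b) <= 1).
  { split; [apply Rdiv_lt_0_compat; assumption|].
    apply (Rmult_le_reg_r (euler (S N) (INR n * b))); [exact Eb|].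
    unfold Rdiv; rewrite Rmult_assoc, Rinv_l, Rmult_1_r, Rmult_1_l by lra.
    apply inv_Gamma_le_euler, Hnb. }
  assert (Hrn : 0 < r ^ n) by (apply pow_lt, Hr).
  rewrite (Rabs_pos_eq (euler (S N) (INR n * a) * _)) by (apply Rmult_le_pos; lra).
  apply Rmult_le_compat; [apply Rabs_pos| |apply Hv|].
  + apply Rmult_le_pos; [apply Rmult_le_pos|]; lra.
  + apply Rle_trans with (2 := HB N n HN); apply Rmult_le_compat_r; [lra|].
    rewrite <- (Rmult_1_r (euler (S N) (INR n * a))) at 2; apply Rmult_le_compat_l; lra.
- intros n; assert (Hn := pos_INR n).
  assert (Hna : 0 <= INR n * a) by (apply Rmult_le_pos; lra).
  assert (Hnb : 0 <= INR n * b) by (apply Rmult_le_pos; lra).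
  assert (Hml : 0 < ml_coef b n) by (apply ml_coef_pos; lra).
  apply (is_lim_seq_ext _ _ _ (fun N => eq_sym (Heq N n))).
  replace (v n * ml_coef a n) with (v n * (ml_coef a n * (ml_coef b n / ml_coef b n))) by (field; lra).
  apply (is_lim_seq_scal_l _ (v n) (Finite _)).
  apply is_lim_seq_mult'; [apply is_lim_euler, Hna|].
  apply is_lim_seq_div'; [apply is_lim_seq_const|apply is_lim_euler, Hnb|lra].
Qed.

Lemma convex_rescaled (N : nat) (a b : R) (d : nat -> R) : 0 <= a -> a <= b -> 0 < b ->
  convex_entire d -> convex_entire (rescaled N a b d).
Proof. intros; apply convex_dilate; [apply exp_pos|apply convex_iterated; assumption]. Qed.

(** Second derivatives inherit the uniform bounds, so they converge pointwise and their sign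
    persists. *)
Lemma convex_limit (e : nat -> nat -> R) (d : nat -> R) :
  (forall N, convex_entire (e N)) -> uniformly_entire e ->
  (forall n, is_lim_seq (fun N => e N n) (d n)) -> convex_entire d.
Proof.
intros Hc He Hl; split; [exact (entire_lim e d He Hl)|]; intros x.
apply (is_lim_seq_le (fun _ => 0) (fun N => PSeries (PS_derive2 (e N)) x)
         0 (PSeries (PS_derive2 d) x)).
- intros N; apply Hc.
- apply is_lim_seq_const.
- apply (is_lim_PSeries (fun N => PS_derive2 (e N))).
  + intros N; apply entire_derive2, Hc.
  + apply (uniformly_entire_derive (fun N => PS_derive (e N))), uniformly_entire_derive, He.
  + intros n; unfold PS_derive2, PS_derive.
    do 2 apply (is_lim_seq_scal_l _ _ (Finite _)); apply Hl.
Qed.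

Lemma convex_exp : convex_entire (ml_coef 1).
Proof.
assert (Heq : forall n, / INR (fact n) = ml_coef 1 n).
{ intros n; unfold ml_coef; rewrite Rmult_1_r, Gamma_fact; reflexivity. }
split; [apply entire_ml_coef; lra|].
intros x; rewrite (PSeries_ext _ (fun n => / INR (fact n))).
- rewrite <- exp_Reals; apply Rlt_le, exp_pos.
- intros n; unfold PS_derive2, PS_derive; rewrite <- Heq, !fact_simpl, !mult_INR.
  assert (H1 := INR_S_pos n); assert (H2 := INR_S_pos (S n)); assert (H3 := INR_fact_lt_0 n).
  field; lra.
Qed.

(** From [exp], the operators with [i >= 2] give in the limit a convex series [h]; the operator
    [i = 1], applied last, turns [h] into [ml_coef b] and makes convexity strict. *)
Lemma ml_strictly_convex (b : R) : 0 < b < 1 ->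
  entire (ml_coef b) /\ forall x, 0 < PSeries (PS_derive2 (ml_coef b)) x.
Proof.
intros Hb; split; [apply entire_ml_coef; lra|].
(* The inverse of the [i = 1] multiplier, so that the sequence to be rescaled is exactly
   [ml_coef 1]. *)
set (v := fun n => (1 + INR n) / (1 + INR n * b)).
assert (Hv : forall n, Rabs (v n) <= / b).
{ intros n; assert (Hn := pos_INR n); assert (Hnb := affine_pos 1 b n Rlt_0_1 (proj1 Hb)).
  unfold v; rewrite Rabs_pos_eq by (apply Rdiv_le_0_compat; lra).
  apply (Rmult_le_reg_r (b * (1 + INR n * b))); [apply Rmult_lt_0_compat; lra|].
  replace ((1 + INR n) / (1 + INR n * b) * (b * (1 + INR n * b))) with (b + INR n * b)
    by (field; lra).
  replace (/ b * (b * (1 + INR n * b))) with (1 + INR n * b) by (field; lra).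
  lra. }
assert (Hd : forall n, ml_coef 1 n = v n * ((1 + INR n * b) / (1 + INR n * 1)) * ml_coef 1 n).
{ intros n; assert (Hn := pos_INR n); assert (Hnb := affine_pos 1 b n Rlt_0_1 (proj1 Hb)).
  unfold v; field; lra. }
destruct (rescaled_limit b 1 (/ b) v (ml_coef 1) ltac:(lra) ltac:(lra) Hv Hd) as [HU HL].
set (h := fun n => v n * ml_coef b n) in *.
assert (Hh : convex_entire h).
{ apply (convex_limit (fun N => rescaled N b 1 (ml_coef 1))); [|exact HU|exact HL].
  intros N; apply convex_rescaled; try lra; apply convex_exp. }
intros x; rewrite (PSeries_ext _ (PS_derive2 (homographic 1 b 1 1 h))).
- apply strictly_convex_homographic; try lra; [exact Hh|].
  unfold h, v; apply Rmult_lt_0_compat; [|apply ml_coef_pos; lra].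
  simpl; apply Rdiv_lt_0_compat; lra.
- intros n; unfold PS_derive2, PS_derive; do 2 f_equal.
  unfold homographic, h, v; set (m := S (S n)); assert (Hm := pos_INR m).
  assert (Hmb := affine_pos 1 b m Rlt_0_1 (proj1 Hb)); field; lra.
Qed.

Theorem theoremC :
  forall x : R, x <> 0 ->
  forall a b : R, 0 < a -> a < b -> b < 1 ->
    MittagLeffler b (Gamma (1 + b) * x) < MittagLeffler a (Gamma (1 + a) * x).
Proof.
intros x Hx a b Ha Hab Hb; rewrite !MittagLeffler_PSeries.
destruct (ml_strictly_convex b ltac:(lra)) as [Hent Hpos].
assert (Hml : convex_entire (ml_coef b)) by (split; [exact Hent|intros t; apply Rlt_le, Hpos]).
(* Here the operator [i = 1] acts first; those with [i >= 2] then lead from [h] to [ml_coef a] in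
   the limit. *)
set (h := homographic 1 a 1 b (ml_coef b)).
assert (Hh : convex_entire h) by (apply convex_homographic; try assumption; lra).
destruct (rescaled_limit a b 1 (fun _ => 1) h ltac:(lra) ltac:(lra)) as [HU HL].
{ intros _; rewrite Rabs_R1; lra. }
{ intros n; unfold h, homographic; rewrite Rmult_1_l; apply Rmult_comm. }
destruct (Gamma_spec a ltac:(lra)) as [_ HGa]; destruct (Gamma_spec b ltac:(lra)) as [_ HGb].
(* [z] is the limit of the Jensen means of the operators [i >= 2] for the argument [y]; the mean of
   the operator [i = 1] then brings [z] to [Gamma (1 + b) * x]. *)
set (y := Gamma (1 + a) * x); set (z := (1 + b) / (1 + a) * (Gamma (1 + b) * x)).
assert (Hge : PSeries h z <= PSeries (ml_coef a) y).
{ apply (is_lim_seq_le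
    (fun N => PSeries h (tail_quotient N a b * (Rpower (INR (S N)) (b - a) * y)))
    (fun N => PSeries (rescaled N a b h) y) (PSeries h z) (PSeries (ml_coef a) y)).
  - intros N; unfold rescaled; rewrite PSeries_dilate; apply iterated_jensen; try assumption; lra.
  - apply is_lim_seq_continuous; [apply PSeries_continuity, entire_radius, Hh|].
    apply (is_lim_seq_ext (fun N => (1 + b) / (1 + a) * (euler (S N) a / euler (S N) b) * y)).
    (* The coefficient of index 1, for the constant sequence 1, is precisely the mean times the
       dilation factor. *)
    + intros N; assert (HE := rescaled_euler N a b (fun _ => 1) 1 ltac:(lra) ltac:(lra)).
      unfold rescaled, dilate, iterated in HE; change (INR 1) with 1 in HE; rewrite !Rmult_1_l, pow_1 in HE.
      rewrite <- HE; ring.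
    + replace z with ((1 + b) / (1 + a) * (/ Gamma (1 + a) / / Gamma (1 + b)) * y)
        by (unfold z, y; field; lra).
      apply is_lim_seq_mult'; [|apply is_lim_seq_const].
      apply (is_lim_seq_scal_l _ _ (Finite _)).
      assert (0 < / Gamma (1 + b)) by (apply Rinv_0_lt_compat, HGb).
      apply is_lim_seq_div'; [apply is_lim_euler; lra|apply is_lim_euler; lra|lra].
  - apply is_lim_PSeries; [|exact HU|].
    + intros N; apply convex_rescaled; try assumption; lra.
    + intros n; generalize (HL n); rewrite Rmult_1_l; trivial. }
apply Rlt_le_trans with (2 := Hge).
assert (HJ := homographic_jensen 1 a b (ml_coef b) z ltac:(lra) ltac:(lra) ltac:(lra) ltac:(lra) Hml).
cbv zeta in HJ; fold h in HJ.
replace ((1 + a) / (1 + b) * z) with (Gamma (1 + b) * x) in HJ by (unfold z; field; lra).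
set (p := Gamma (1 + b) * x) in *.
assert (Hp : p <> 0) by (unfold p; apply Rmult_integral_contrapositive_currified; [lra|exact Hx]).
(* [p] and [z] differ by the factor [(1 + b) / (1 + a)], different from 1, and [p] is nonzero. Hence
   the Taylor remainder between them is strictly positive, and so is its multiple by the atom
   [a / b]. *)
assert (Hpz : p <> z).
{ intros Heq; apply Hp, (Rmult_eq_reg_l (b - a)); [|lra].
  assert (H : (1 + a) * p = (1 + b) * p) by (rewrite Heq at 1; unfold z; field; lra).
  lra. }
destruct (PSeries_taylor2 (ml_coef b) p z Hent Hpz) as (k & t & Hk & Ht).
assert (0 < a / b) by (apply Rdiv_lt_0_compat; lra).
assert (0 < a / b * (k * PSeries (PS_derive2 (ml_coef b)) t))
  by (apply Rmult_lt_0_compat; [assumption|apply Rmult_lt_0_compat; [exact Hk|apply Hpos]]).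
replace (PSeries (ml_coef b) z - PSeries (ml_coef b) p - PSeries (PS_derive (ml_coef b)) p * (z - p))
  with (k * PSeries (PS_derive2 (ml_coef b)) t) in HJ by lra.
lra.
Qed.
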